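(* Let $X\subset\Delta$ be a subdomain of the unit disk $\Delta$ that is not a $\rho$-Bloch subdomain of $\Delta$. Then $X$ is not degenerate in $\Delta$.
   Context: $\Delta=\{z\in\mathbb{C}:|z|<1\}$. A subdomain of $\Delta$ is a nonempty connected open subset of $\Delta$ (possibly $\Delta$ itself). $\rho$ denotes the Poincaré (hyperbolic) metric on $\Delta$ with density $\rho(z)=\frac{1}{1-|z|^2}$, and $\rho(\cdot,\cdot)$ also denotes the associated distance. $\rho$-Bloch: for a subdomain $X$ of $\Delta$, let $R(X,\Delta)$ be the supremum of all radii (measured with respect to $\rho$) of hyperbolic disks $\{z\in\Delta:\rho(z,p)<r\}$ that are contained in $X$. $X$ is a $\rho$-Bloch subdomain of $\Delta$ if $R(X,\Delta)<\infty$. Degenerate: given a sequence $f_1,f_2,f_3,\ldots$ of holomorphic maps $f_n:\Delta\to X$, the iterated function system generated by it is the sequence $F_n=f_1\circ f_2\circ\cdots\circ f_n:\Delta\to X\subset\Delta$. An accumulation point of $(F_n)$ is a holomorphic function $F$ on $\Delta$ that is the limit, uniformly on compact subsets of $\Delta$, of some subsequence of $(F_n)$. $X$ is degenerate in $\Delta$ if every iterated function system generated by a sequence of holomorphic maps from $\Delta$ to $X$ has only constant accumulation points. *)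

(* Defs.v *)
From Stdlib Require Import Reals List.
From Coquelicot Require Import Coquelicot.
Open Scope R_scope.

(** * Topology

    Connectedness and open-cover compactness, which Coquelicot does not provide
    for subsets of a uniform space. *)

Definition connected_set {T : UniformSpace} (A : T -> Prop) : Prop :=
  forall U V : T -> Prop,
    open U -> open V ->
    (forall x, A x -> U x \/ V x) ->
    (exists x, A x /\ U x) ->
    (exists x, A x /\ V x) ->
    exists x, A x /\ U x /\ V x.

Definition compact_set {T : UniformSpace} (K : T -> Prop) : Prop :=
  forall (I : Type) (U : I -> T -> Prop),
    (forall i, open (U i)) ->
    (forall x, K x -> exists i, U i x) ->
    exists l : list I, forall x, K x -> exists i, In i l /\ U i x.

(** * The unit disk and its subdomains *)

Definition Delta (z : C) : Prop := Cmod z < 1.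

Definition subdomain (X : C -> Prop) : Prop :=
  (forall z, X z -> Delta z) /\
  (exists z, X z) /\
  open (X : C_UniformSpace -> Prop) /\
  connected_set (X : C_UniformSpace -> Prop).

(** * The Poincare metric *)

Definition rho_density (z : C) : R := / (1 - Cmod z ^ 2).

(** [gamma] is a [C^1] path in [Delta] from [z] to [w], parametrized by [[0,1]],
    with velocity [dgamma].  The velocity may vanish, so a piecewise [C^1] path
    can be reparametrized to such a path of the same length.  Both functions are
    total on [R] and Coquelicot's derivative and continuity are two-sided; this
    is no restriction, since a [C^1] path on [[0,1]] extends affinely. *)
Definition C1_path (gamma dgamma : R -> C) (z w : C) : Prop :=
  gamma 0 = z /\ gamma 1 = w /\
  forall t, 0 <= t <= 1 ->
    Delta (gamma t) /\
    @is_derive R_AbsRing C_R_NormedModule gamma t (dgamma t) /\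
    @continuous R_UniformSpace C_UniformSpace dgamma t.

Definition rho_length (gamma dgamma : R -> C) : R :=
  RInt (fun t => rho_density (gamma t) * Cmod (dgamma t)) 0 1.

(** For [z] and [w] in [Delta] the set of lengths is nonempty and bounded below
    by [0], so the infimum is finite and [real] loses nothing. *)
Definition rho_dist (z w : C) : R :=
  real (Glb_Rbar (fun L => exists gamma dgamma : R -> C,
                    C1_path gamma dgamma z w /\ L = rho_length gamma dgamma)).

Definition rho_disk (p : C) (r : R) (z : C) : Prop :=
  Delta z /\ rho_dist z p < r.

(** * Bloch subdomains *)

Definition Bloch_radius (X : C -> Prop) : Rbar :=
  Lub_Rbar (fun r => 0 < r /\
              exists p, Delta p /\ forall z, rho_disk p r z -> X z).

Definition rho_Bloch (X : C -> Prop) : Prop :=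
  Rbar_lt (Bloch_radius X) p_infty.

(** * Holomorphic maps and iterated function systems

    Maps on [Delta] are total functions on [C] of which only the values on
    [Delta] matter. *)

Definition holomorphic_on_Delta (f : C -> C) : Prop :=
  forall z, Delta z -> @ex_derive C_AbsRing C_NormedModule f z.

Definition holomorphic_map_into (X : C -> Prop) (f : C -> C) : Prop :=
  holomorphic_on_Delta f /\ forall z, Delta z -> X (f z).

(** The sequence is indexed from [0]: [IFS f n] is [f 0 o f 1 o ... o f n]. *)
Fixpoint IFS (f : nat -> C -> C) (n : nat) (z : C) : C :=
  match n with
  | O => f O z
  | S m => IFS f m (f (S m) z)
  end.

Definition locally_uniform_limit (G : nat -> C -> C) (F : C -> C) : Prop :=
  forall K : C -> Prop,
    compact_set (K : C_UniformSpace -> Prop) ->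
    (forall z, K z -> Delta z) ->
    forall eps : R, 0 < eps ->
    eventually (fun n => forall z, K z -> Cmod (G n z - F z) < eps).

Definition accumulation_point (G : nat -> C -> C) (F : C -> C) : Prop :=
  holomorphic_on_Delta F /\
  exists phi : nat -> nat,
    (forall n m, (n < m)%nat -> (phi n < phi m)%nat) /\
    locally_uniform_limit (fun n => G (phi n)) F.

Definition constant_on_Delta (F : C -> C) : Prop :=
  exists c : C, forall z, Delta z -> F z = c.

Definition degenerate (X : C -> Prop) : Prop :=
  forall f : nat -> C -> C,
    (forall n, holomorphic_map_into X (f n)) ->
    forall F : C -> C, accumulation_point (IFS f) F -> constant_on_Delta F.

(* Main.v *)
Require Import Defs.
From Stdlib Require Import Reals Lra Lia List Classical ClassicalEpsilon.
From Coquelicot Require Import Coquelicot.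
Open Scope R_scope.

(** The proof builds one explicit iterated function system in [X] that converges
    to a nonconstant map.  Write [A_p z = (p - z) / (1 - conj p * z)] for the
    involution of the disk exchanging [0] and [p].

    Supply of disks.  The image under [A_p] of the Euclidean disk of radius
    [t < 1] about [0] is a hyperbolic disk about [p] whose radius depends on [t]
    only, so a domain that is not Bloch contains such images for [t] arbitrarily
    close to [1].  If [x] is a point of the unit disk outside [X], the image
    misses [x], that is [|A_p x| >= t], and this forces [|p|] towards [1] as [t]
    tends to [1].  So there are centres [p_n] and radii [t_n = 1 - e_n] with
    [1 - |p_n| <= e_n], [e_n = 2^-n / 8] and [A_(p_n)] mapping the disk of radius
    [t_n] into [X] ([non_Bloch_disk_near_boundary]).

    The maps.  If each map undid the next involution by an automorphism, an
    [A_p] with [p] near the circle would remain as the innermost factor of the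
    composition, and such an [A_p] is almost constant on compact sets.  The
    Blaschke product [g_p z = (conj p / |p|) * z * A_p z] of degree two undoes it
    without this defect.
    Near [0] the factor [(conj p / |p|) * A_p z] is almost [1], so [g_p] is almost
    the identity; and since [A_p] is an involution, it merely swaps the two factors
    [z] and [A_p z], so that [g_p o A_p = g_p].  With
    [h_n = t_n * g_(p_(n+1))] and [f_n = A_(p_n) o h_n] the map [f_n] takes the
    disk into [X], and the inner involutions cancel:
    [f_0 o ... o f_n = A_(p_0) o h_0 o ... o h_n] ([IFS_cancel_mobius]).

    Convergence.  On each disk of radius [r < 1] the distance from [h_n] to the
    identity is at most a constant times [2^-n], so the compositions
    [h_0 o ... o h_n] converge locally uniformly, and the derivative at [0] of
    the limit is the product of the [t_n * |p_(n+1)|], which is not [0].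

    Holomorphy of the limit is obtained without Cauchy's formula: every map is
    carried along with its divided difference [q z w = (f z - f w) / (z - w)],
    extended over the diagonal.  Being bounded and Lipschitz is preserved by
    composition and by limits, and a Lipschitz divided difference gives a complex
    derivative.  See [slopes], [IFS_slopes] and [IFS_limit_slopes]. *)

(** * Geometrically convergent complex sequences *)

Lemma half_pow_pos (n : nat) : 0 < (1 / 2) ^ n.
Proof. apply pow_lt; lra. Qed.

Lemma half_pow_le_1 (n : nat) : (1 / 2) ^ n <= 1.
Proof. induction n; simpl; [lra | pose proof (half_pow_pos n); lra]. Qed.

Lemma half_pow_small (eps : R) :
  0 < eps -> exists N, forall n, (N <= n)%nat -> (1 / 2) ^ n < eps.
Proof.
  intros He.
  destruct (pow_lt_1_zero (1 / 2)) with (y := eps) as [N HN];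
    [rewrite Rabs_pos_eq; lra | exact He |].
  exists N; intros n Hn. specialize (HN n Hn).
  now rewrite Rabs_pos_eq in HN by apply Rlt_le, half_pow_pos.
Qed.

Lemma le_of_le_plus_half_pow (x y B : R) :
  (forall n, x <= y + B * (1 / 2) ^ n) -> x <= y.
Proof.
  intros H. apply Rnot_lt_le; intros Hlt.
  destruct (half_pow_small ((x - y) / (Rabs B + 1))) as [N HN].
  { apply Rdiv_lt_0_compat; [lra | pose proof (Rabs_pos B); lra]. }
  specialize (H N). specialize (HN N (Nat.le_refl N)).
  pose proof (Rabs_pos B). pose proof (Rle_abs B). pose proof (half_pow_pos N).
  apply (Rmult_lt_compat_l (Rabs B + 1)) in HN; [|lra].
  replace ((Rabs B + 1) * ((x - y) / (Rabs B + 1))) with (x - y) in HN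
    by (field; lra).
  nra.
Qed.

Lemma Cmod_minus_sym (a b : C) : Cmod (a - b) = Cmod (b - a).
Proof. replace (a - b)%C with (- (b - a))%C by ring. apply Cmod_opp. Qed.

Lemma Cmod_triangle_minus (a b : C) : Cmod (a - b) <= Cmod a + Cmod b.
Proof. rewrite <- (Cmod_opp b). apply Cmod_triangle. Qed.

Lemma Cmod_triangle_inv (a b : C) : Cmod a - Cmod b <= Cmod (a - b).
Proof.
  pose proof (Cmod_triangle (a - b) b) as H.
  replace (a - b + b)%C with a in H by ring. lra.
Qed.

Lemma Cmod_le_Re_Im (z : C) : Cmod z <= Rabs (Re z) + Rabs (Im z).
Proof.
  apply Rsqr_incr_0_var; [| pose proof (Rabs_pos (Re z)); pose proof (Rabs_pos (Im z)); lra].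
  unfold Rsqr. replace (Cmod z * Cmod z) with (Cmod z ^ 2) by ring.
  rewrite Cmod2_alt, <- (pow2_abs (Re z)), <- (pow2_abs (Im z)).
  pose proof (Rabs_pos (Re z)); pose proof (Rabs_pos (Im z)). nra.
Qed.

(** Every limit below is approached at the rate [2^-n], so bounds pass to the
    limit through [le_of_le_plus_half_pow] with explicit constants. *)
Definition geom_lim (u : nat -> C) (l : C) : Prop :=
  exists B, forall n, Cmod (u n - l) <= B * (1 / 2) ^ n.

Lemma geom_lim_minus (u v : nat -> C) (a b : C) :
  geom_lim u a -> geom_lim v b -> geom_lim (fun n => u n - v n)%C (a - b).
Proof.
  intros [A HA] [B HB]. exists (A + B); intros n.
  replace (u n - v n - (a - b))%C with ((u n - a) - (v n - b))%C by ring.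
  pose proof (Cmod_triangle_minus (u n - a) (v n - b)).
  specialize (HA n). specialize (HB n). lra.
Qed.

Lemma geom_lim_scal (c : C) (u : nat -> C) (a : C) :
  geom_lim u a -> geom_lim (fun n => c * u n)%C (c * a)%C.
Proof.
  intros [A HA]. exists (Cmod c * A); intros n.
  replace (c * u n - c * a)%C with (c * (u n - a))%C by ring.
  rewrite Cmod_mult, Rmult_assoc.
  apply Rmult_le_compat_l; [apply Cmod_ge_0 | apply HA].
Qed.

Lemma geom_lim_ext (u v : nat -> C) (a : C) :
  (forall n, u n = v n) -> geom_lim u a -> geom_lim v a.
Proof. intros E [A HA]. exists A; intros n. now rewrite <- E. Qed.

Lemma geom_lim_bound (u : nat -> C) (a : C) (B : R) :
  (forall n, Cmod (u n) <= B) -> geom_lim u a -> Cmod a <= B.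
Proof.
  intros HB [A HA]. apply (le_of_le_plus_half_pow _ _ A); intros n.
  specialize (HA n). specialize (HB n).
  rewrite Cmod_minus_sym in HA.
  pose proof (Cmod_triangle_inv a (u n)). lra.
Qed.

Lemma geom_lim_lower_bound (u : nat -> C) (a : C) (B : R) :
  (forall n, B <= Cmod (u n)) -> geom_lim u a -> B <= Cmod a.
Proof.
  intros HB [A HA]. apply (le_of_le_plus_half_pow _ _ A); intros n.
  specialize (HA n). specialize (HB n).
  pose proof (Cmod_triangle_inv (u n) a). lra.
Qed.

Lemma geom_lim_unique (u : nat -> C) (a b : C) :
  geom_lim u a -> geom_lim u b -> a = b.
Proof.
  intros Ha Hb. pose proof (geom_lim_minus _ _ _ _ Ha Hb) as H.
  apply (geom_lim_bound _ _ 0) in H.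
  - pose proof (Cmod_ge_0 (a - b)).
    assert (E : (a - b)%C = 0) by (apply Cmod_eq_0; lra).
    replace a with (a - b + b)%C by ring. rewrite E. ring.
  - intros n. replace (u n - u n)%C with (RtoC 0) by ring. rewrite Cmod_0; lra.
Qed.

Lemma geom_telescope (u : nat -> R) (B : R) :
  (forall n, Rabs (u (S n) - u n) <= B * (1 / 2) ^ n) ->
  forall n k, Rabs (u (n + k)%nat - u n) <= 2 * B * ((1 / 2) ^ n - (1 / 2) ^ (n + k)).
Proof.
  intros H n k. induction k as [|k IH].
  - rewrite Nat.add_0_r, Rminus_diag, Rabs_R0. lra.
  - rewrite Nat.add_succ_r. specialize (H (n + k)%nat).
    replace (u (S (n + k)) - u n) with
      ((u (S (n + k)) - u (n + k)%nat) + (u (n + k)%nat - u n)) by ring.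
    eapply Rle_trans; [apply Rabs_triang|]. simpl. lra.
Qed.

Lemma geom_Cauchy_lim_R (u : nat -> R) (B : R) :
  (forall n, Rabs (u (S n) - u n) <= B * (1 / 2) ^ n) ->
  forall n, Rabs (u n - real (Lim_seq u)) <= 2 * B * (1 / 2) ^ n.
Proof.
  intros H. pose proof (geom_telescope u B H) as HT.
  assert (HB : 0 <= B).
  { specialize (H 0%nat). pose proof (Rabs_pos (u 1%nat - u 0%nat)). simpl in H. lra. }
  assert (HT' : forall n k, Rabs (u (n + k)%nat - u n) <= 2 * B * (1 / 2) ^ n).
  { intros n k. specialize (HT n k). pose proof (half_pow_pos (n + k)). nra. }
  assert (Hlim : is_lim_seq u (real (Lim_seq u))).
  { apply Lim_seq_correct', ex_lim_seq_cauchy_corr. intros eps.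
    destruct (half_pow_small (eps / (4 * B + 1))) as [N HN].
    { apply Rdiv_lt_0_compat; [apply eps | lra]. }
    specialize (HN N (Nat.le_refl N)).
    apply (Rmult_lt_compat_l (4 * B + 1)) in HN; [|lra].
    replace ((4 * B + 1) * (eps / (4 * B + 1))) with (pos eps) in HN by (field; lra).
    exists N; intros n m Hn Hm.
    pose proof (HT' N (n - N)%nat) as H1. pose proof (HT' N (m - N)%nat) as H2.
    replace (N + (n - N))%nat with n in H1 by lia.
    replace (N + (m - N))%nat with m in H2 by lia.
    replace (u n - u m) with ((u n - u N) - (u m - u N)) by ring.
    eapply Rle_lt_trans; [apply Rabs_triang|]. rewrite Rabs_Ropp.
    pose proof (half_pow_pos N). lra. }
  intros n.
  apply is_lim_seq_spec in Hlim. apply le_epsilon; intros eps Heps.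
  destruct (Hlim (mkposreal eps Heps)) as [N HN]. simpl in HN.
  specialize (HN (n + N)%nat ltac:(lia)). specialize (HT' n N).
  replace (u n - real (Lim_seq u)) with
    ((u (n + N)%nat - real (Lim_seq u)) - (u (n + N)%nat - u n)) by ring.
  eapply Rle_trans; [apply Rabs_triang|]. rewrite Rabs_Ropp. lra.
Qed.

(** Taken coordinatewise, which makes it a total operation: the limit map of a
    sequence of maps can be written down before it is known to exist. *)
Definition Clim (u : nat -> C) : C :=
  (real (Lim_seq (fun n => Re (u n))), real (Lim_seq (fun n => Im (u n)))).

(** The complex bound is twice the real one because the modulus is estimated by
    the sum of the two coordinates. *)
Lemma geom_Cauchy_lim (u : nat -> C) (B : R) :
  (forall n, Cmod (u (S n) - u n) <= B * (1 / 2) ^ n) ->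
  forall n, Cmod (u n - Clim u) <= 4 * B * (1 / 2) ^ n.
Proof.
  intros H n. eapply Rle_trans; [apply Cmod_le_Re_Im|].
  assert (Hr := geom_Cauchy_lim_R (fun n => Re (u n)) B).
  assert (Hi := geom_Cauchy_lim_R (fun n => Im (u n)) B).
  replace (4 * B * (1 / 2) ^ n)
    with (2 * B * (1 / 2) ^ n + 2 * B * (1 / 2) ^ n) by ring.
  apply Rplus_le_compat; [apply Hr | apply Hi]; intros k;
    (eapply Rle_trans; [| apply (H k)]);
    (eapply Rle_trans; [| apply Rmax_Cmod]);
    destruct (u (S k)), (u k); simpl; [apply Rmax_l | apply Rmax_r].
Qed.

(** * Divided differences *)

(** [q] is the divided difference of [f] on the closed disk of radius [r].  The
    Lipschitz condition stands in for a bound on the second derivative; unlike a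
    condition on derivatives it is visibly stable under pointwise limits. *)
Record slopes (r L M : R) (f : C -> C) (q : C -> C -> C) : Prop := {
  slopes_eq : forall z w, Cmod z <= r -> Cmod w <= r ->
    (f z - f w = (z - w) * q z w)%C;
  slopes_sym : forall z w, Cmod z <= r -> Cmod w <= r -> q z w = q w z;
  slopes_bound : forall z w, Cmod z <= r -> Cmod w <= r -> Cmod (q z w) <= L;
  slopes_lip : forall z z' w, Cmod z <= r -> Cmod z' <= r -> Cmod w <= r ->
    Cmod (q z w - q z' w) <= M * Cmod (z - z') }.

Section Slopes.
Variables (r L M : R) (f : C -> C) (q : C -> C -> C).
Hypothesis S : slopes r L M f q.

Lemma slopes_fun_lip (z w : C) : Cmod z <= r -> Cmod w <= r ->
  Cmod (f z - f w) <= L * Cmod (z - w).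
Proof.
  intros Hz Hw. rewrite (slopes_eq _ _ _ _ _ S z w Hz Hw), Cmod_mult, Rmult_comm.
  apply Rmult_le_compat_r; [apply Cmod_ge_0 | now apply (slopes_bound _ _ _ _ _ S)].
Qed.

Lemma slopes_lip2 (z z' w w' : C) :
  Cmod z <= r -> Cmod z' <= r -> Cmod w <= r -> Cmod w' <= r ->
  Cmod (q z w - q z' w') <= M * (Cmod (z - z') + Cmod (w - w')).
Proof.
  intros Hz Hz' Hw Hw'.
  replace (q z w - q z' w')%C with ((q z w - q z' w) + (q z' w - q z' w'))%C by ring.
  eapply Rle_trans; [apply Cmod_triangle|].
  rewrite Rmult_plus_distr_l. apply Rplus_le_compat.
  - now apply (slopes_lip _ _ _ _ _ S).
  - rewrite (slopes_sym _ _ _ _ _ S z' w), (slopes_sym _ _ _ _ _ S z' w') by assumption.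
    now apply (slopes_lip _ _ _ _ _ S).
Qed.

Lemma slopes_weaken (L' M' : R) : L <= L' -> M <= M' -> slopes r L' M' f q.
Proof.
  intros HL HM. destruct S as [S1 S2 S3 S4]. split; auto.
  - intros z w Hz Hw. specialize (S3 z w Hz Hw). lra.
  - intros z z' w Hz Hz' Hw. eapply Rle_trans; [now apply S4|].
    apply Rmult_le_compat_r; [apply Cmod_ge_0 | exact HM].
Qed.

(** [f y - f z - (y - z) q z z = (y - z) (q y z - q z z)], which is quadratically
    small. *)
Lemma slopes_is_derive (z : C) : Cmod z < r ->
  @is_derive C_AbsRing C_NormedModule f z (q z z).
Proof.
  intros Hz. split; [apply is_linear_scal_l|].
  intros x Hx. apply (@is_filter_lim_locally_unique C_AbsRing (AbsRing_NormedModule C_AbsRing) z x) in Hx.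
  subst x.
  intros eps. set (K := Rabs M + 1).
  assert (HK : 0 < K) by (unfold K; pose proof (Rabs_pos M); lra).
  assert (Hd : 0 < Rmin (r - Cmod z) (eps / K)).
  { apply Rmin_pos; [lra | apply Rdiv_lt_0_compat; [apply eps | exact HK]]. }
  exists (mkposreal _ Hd). intros y Hy.
  change (Cmod (y - z) < Rmin (r - Cmod z) (eps / K)) in Hy.
  change (Cmod ((f y - f z) - (y - z) * q z z) <= eps * Cmod (y - z)).
  pose proof (Rmin_l (r - Cmod z) (eps / K)). pose proof (Rmin_r (r - Cmod z) (eps / K)).
  pose proof (Cmod_triangle_inv y z).
  assert (Hyr : Cmod y <= r) by lra. assert (Hzr : Cmod z <= r) by lra.
  rewrite (slopes_eq _ _ _ _ _ S y z Hyr Hzr).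
  replace ((y - z) * q y z - (y - z) * q z z)%C
    with ((y - z) * (q y z - q z z))%C by ring.
  rewrite Cmod_mult, Rmult_comm. apply Rmult_le_compat_r; [apply Cmod_ge_0|].
  eapply Rle_trans; [now apply (slopes_lip _ _ _ _ _ S)|].
  apply Rle_trans with (K * (eps / K)); [| right; field; lra].
  pose proof (Cmod_ge_0 (y - z)). pose proof (Rle_abs M).
  apply Rle_trans with (K * Cmod (y - z)).
  - apply Rmult_le_compat_r; [assumption | unfold K; lra].
  - apply Rmult_le_compat_l; lra.
Qed.

End Slopes.

(** The chain rule for divided differences is exact:
    [g (h z) - g (h w) = (z - w) * qg (h z) (h w) * qh z w]. *)
Lemma slopes_comp (r r' Lg Mg Lh Mh : R) (g h : C -> C) (qg qh : C -> C -> C) :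
  slopes r' Lg Mg g qg -> slopes r Lh Mh h qh ->
  (forall z, Cmod z <= r -> Cmod (h z) <= r') ->
  0 <= Lh -> 0 <= Lg -> 0 <= Mg ->
  slopes r (Lg * Lh) (Mg * Lh ^ 2 + Lg * Mh)
    (fun z => g (h z)) (fun z w => qg (h z) (h w) * qh z w)%C.
Proof.
  intros Sg Sh Hh HLh HLg HMg. split.
  - intros z w Hz Hw.
    rewrite (slopes_eq _ _ _ _ _ Sg), (slopes_eq _ _ _ _ _ Sh) by auto. ring.
  - intros z w Hz Hw.
    now rewrite (slopes_sym _ _ _ _ _ Sg), (slopes_sym _ _ _ _ _ Sh) by auto.
  - intros z w Hz Hw. rewrite Cmod_mult.
    apply Rmult_le_compat; try apply Cmod_ge_0;
      [apply (slopes_bound _ _ _ _ _ Sg) | apply (slopes_bound _ _ _ _ _ Sh)]; auto.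
  - intros z z' w Hz Hz' Hw.
    replace (qg (h z) (h w) * qh z w - qg (h z') (h w) * qh z' w)%C with
      ((qg (h z) (h w) - qg (h z') (h w)) * qh z w
       + qg (h z') (h w) * (qh z w - qh z' w))%C by ring.
    eapply Rle_trans; [apply Cmod_triangle|]. rewrite !Cmod_mult.
    pose proof (slopes_lip _ _ _ _ _ Sg (h z) (h z') (h w) ltac:(auto) ltac:(auto) ltac:(auto)) as H1.
    pose proof (slopes_fun_lip _ _ _ _ _ Sh z z' Hz Hz') as H2.
    pose proof (slopes_bound _ _ _ _ _ Sh z w Hz Hw) as H3.
    pose proof (slopes_bound _ _ _ _ _ Sg (h z') (h w) ltac:(auto) ltac:(auto)) as H4.
    pose proof (slopes_lip _ _ _ _ _ Sh z z' w Hz Hz' Hw) as H5.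
    rewrite Rmult_plus_distr_r. apply Rplus_le_compat.
    + replace (Mg * Lh ^ 2 * Cmod (z - z')) with ((Mg * (Lh * Cmod (z - z'))) * Lh) by ring.
      apply Rmult_le_compat; try apply Cmod_ge_0; [|exact H3].
      eapply Rle_trans; [exact H1|]. apply Rmult_le_compat_l; assumption.
    + rewrite Rmult_assoc. apply Rmult_le_compat; try apply Cmod_ge_0; assumption.
Qed.

(** * Compositions of maps close to the identity *)

(** The divided difference of [IFS h n], by the chain rule. *)
Fixpoint IFS_slope (h : nat -> C -> C) (q : nat -> C -> C -> C) (n : nat) (z w : C) : C :=
  match n with
  | O => q O z w
  | S m => (IFS_slope h q m (h (S m) z) (h (S m) w) * q (S m) z w)%C
  end.

Definition IFS_slope_limit (h : nat -> C -> C) (q : nat -> C -> C -> C) (z w : C) : C :=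
  Clim (fun n => IFS_slope h q n z w).

(** The limit of [IFS h n z], written as [z] times the limit of the divided
    differences at [(z, 0)]: the maps fix [0], so convergence of the divided
    differences is all that has to be proved. *)
Definition IFS_limit (h : nat -> C -> C) (q : nat -> C -> C -> C) (z : C) : C :=
  (z * IFS_slope_limit h q z 0)%C.

Section NearIdentity.
Variables (h : nat -> C -> C) (q : nat -> C -> C -> C).
Hypothesis h_contracts : forall n z, Cmod z < 1 -> Cmod (h n z) <= Cmod z.
Hypothesis h_slopes : forall r, 0 <= r < 1 -> exists K, 0 <= K /\ forall n,
  slopes r (1 + K * (1 / 2) ^ n) (K * (1 / 2) ^ n) (h n) (q n) /\
  forall z w, Cmod z <= r -> Cmod w <= r -> Cmod (q n z w - 1) <= K * (1 / 2) ^ n.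

Let G := IFS_limit h q.
Let Q := IFS_slope_limit h q.


Lemma IFS_contracts (n : nat) : forall z, Cmod z < 1 -> Cmod (IFS h n z) <= Cmod z.
Proof.
  induction n as [|n IH]; intros z Hz; simpl; [auto|].
  pose proof (h_contracts (S n) z Hz). specialize (IH (h (S n) z)). lra.
Qed.

Lemma contraction_fixes_0 (n : nat) : h n 0 = 0.
Proof.
  apply Cmod_eq_0. pose proof (h_contracts n 0). rewrite Cmod_0 in H.
  pose proof (Cmod_ge_0 (h n 0)). lra.
Qed.

Lemma IFS_fixes_0 (n : nat) : IFS h n 0 = 0.
Proof.
  induction n; simpl; rewrite contraction_fixes_0; auto.
Qed.

(** The constants for the compositions stay bounded because the product of the
    factors [1 + K * 2^-n] converges. *)
Lemma IFS_slopes (r : R) : 0 <= r < 1 ->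
  exists E, 0 <= E /\ forall n, slopes r E E (IFS h n) (IFS_slope h q n).
Proof.
  intros Hr. destruct (h_slopes r Hr) as [K [HK HS]].
  (* [K * (2 - 2^-n)] is the sum of [K * 2^-k] for [k <= n], so [E n] dominates the
     product of the [1 + K * 2^-k].  The Lipschitz constants obey
     [M -> M (1 + x)^2 + E x], which [E^3] satisfies. *)
  set (E n := exp (K * (2 - (1 / 2) ^ n))).
  assert (HE : forall n, 1 <= E n).
  { intros n. unfold E. pose proof (half_pow_le_1 n).
    pose proof (exp_ineq1_le (K * (2 - (1 / 2) ^ n))). nra. }
  assert (HES : forall n, E n * (1 + K * (1 / 2) ^ S n) <= E (S n)).
  { intros n. unfold E.
    replace (K * (2 - (1 / 2) ^ S n)) with (K * (2 - (1 / 2) ^ n) + K * (1 / 2) ^ S n)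
      by (simpl; field).
    rewrite exp_plus. apply Rmult_le_compat_l; [apply Rlt_le, exp_pos | apply exp_ineq1_le]. }
  assert (H : forall n, slopes r (E n) (E n ^ 3) (IFS h n) (IFS_slope h q n)).
  { induction n as [|n IH].
    - simpl. destruct (HS 0%nat) as [S0 _].
      assert (1 + K <= E 0%nat).
      { unfold E. replace (K * (2 - (1 / 2) ^ 0)) with K by (simpl; ring). apply exp_ineq1_le. }
      specialize (HE 0%nat).
      apply (slopes_weaken _ _ _ _ _ S0); simpl; [lra|].
      assert (E 0%nat <= E 0%nat * E 0%nat) by nra. nra.
    - destruct (HS (S n)) as [SS _].
      assert (Hx : 0 <= K * (1 / 2) ^ S n).
      { apply Rmult_le_pos; [exact HK | apply Rlt_le, half_pow_pos]. }
      specialize (HES n). pose proof (HE n) as H1.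
      set (x := K * (1 / 2) ^ S n) in *. set (e := E n) in *.
      change (slopes r (E (S n)) (E (S n) ^ 3) (fun z => IFS h n (h (S n) z))
        (fun z w => IFS_slope h q n (h (S n) z) (h (S n) w) * q (S n) z w)%C).
      eapply slopes_weaken; [eapply slopes_comp; [exact IH | exact SS | | lra | lra |] | exact HES |].
      + intros z Hz. apply Rle_trans with (Cmod z); [apply h_contracts; lra | exact Hz].
      + apply pow_le; lra.
      + apply Rle_trans with ((e * (1 + x)) ^ 3).
        * assert (0 <= e ^ 3) by (apply pow_le; lra).
          assert (e <= e ^ 3) by (assert (e <= e * e) by nra; simpl; nra).
          assert (e * x <= e ^ 3 * x) by (apply Rmult_le_compat_r; assumption).
          replace ((e * (1 + x)) ^ 3) with
            (e ^ 3 * (1 + x) ^ 2 + e ^ 3 * x + e ^ 3 * (x * x * (2 + x)))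
            by ring.
          assert (0 <= x * x * (2 + x)) by (apply Rmult_le_pos; nra).
          nra.
        * apply pow_incr. split; [|exact HES]. apply Rmult_le_pos; lra. }
  exists (exp (2 * K) ^ 3).
  assert (HEb : forall n, E n <= exp (2 * K)).
  { intros n. unfold E.     pose proof (half_pow_pos n).
    destruct (Rle_lt_or_eq_dec (K * (2 - (1 / 2) ^ n)) (2 * K)) as [Hl|He]; [nra | |].
    - now apply Rlt_le, exp_increasing.
    - rewrite He; lra. }
  assert (1 <= exp (2 * K)) by (pose proof (HE 0%nat); pose proof (HEb 0%nat); lra).
  split; [apply pow_le; lra|]. intros n.
  specialize (HE n). specialize (HEb n).
  apply (slopes_weaken _ _ _ _ _ (H n)).
  - apply Rle_trans with (1 := HEb).
    assert (exp (2 * K) <= exp (2 * K) * exp (2 * K)) by nra. simpl. nra.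
  - apply pow_incr; lra.
Qed.

(** Composing with one more map changes the divided difference by a factor close
    to [1] and moves its arguments by little; the uniform Lipschitz bound of
    [IFS_slopes] turns both into an error of order [2^-n]. *)
Lemma IFS_slope_geom (r : R) : 0 <= r < 1 ->
  exists B, 0 <= B /\ forall n z w, Cmod z <= r -> Cmod w <= r ->
    Cmod (IFS_slope h q n z w - Q z w) <= B * (1 / 2) ^ n.
Proof.
  intros Hr. destruct (h_slopes r Hr) as [K [HK HS]].
  destruct (IFS_slopes r Hr) as [E [HE HF]].
  assert (Hid : forall n z, Cmod z <= r -> Cmod (h n z - z) <= K * (1 / 2) ^ n).
  { intros n z Hz. destruct (HS n) as [S1 S2].
    assert (H0 : Cmod 0 <= r) by (rewrite Cmod_0; lra).
    pose proof (slopes_eq _ _ _ _ _ S1 z 0 Hz H0) as He.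
    rewrite contraction_fixes_0 in He.
    replace (h n z - z)%C with (z * (q n z 0 - 1))%C.
    - rewrite Cmod_mult. specialize (S2 z 0 Hz H0).
      pose proof (Cmod_ge_0 z). pose proof (Cmod_ge_0 (q n z 0 - 1)). nra.
    - replace (h n z) with (h n z - 0)%C by ring. rewrite He. ring. }
  exists (4 * (E * K + 2 * E * K)). split; [nra|].
  intros n z w Hz Hw. apply (geom_Cauchy_lim (fun n => IFS_slope h q n z w)). clear n. intros n. simpl IFS_slope.
  assert (Hh : forall z, Cmod z <= r -> Cmod (h (S n) z) <= r).
  { intros y Hy. apply Rle_trans with (Cmod y); [apply h_contracts; lra | exact Hy]. }
  replace (IFS_slope h q n (h (S n) z) (h (S n) w) * q (S n) z w - IFS_slope h q n z w)%C
    with (IFS_slope h q n (h (S n) z) (h (S n) w) * (q (S n) z w - 1)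
          + (IFS_slope h q n (h (S n) z) (h (S n) w) - IFS_slope h q n z w))%C by ring.
  eapply Rle_trans; [apply Cmod_triangle|]. rewrite Cmod_mult.
  destruct (HS (S n)) as [_ S2]. specialize (S2 z w Hz Hw).
  pose proof (slopes_bound _ _ _ _ _ (HF n) _ _ (Hh z Hz) (Hh w Hw)) as H1.
  pose proof (slopes_lip2 _ _ _ _ _ (HF n) _ _ _ _ (Hh z Hz) Hz (Hh w Hw) Hw) as H2.
  pose proof (Hid (S n) z Hz) as H3. pose proof (Hid (S n) w Hw) as H4.
  assert (Hp : (1 / 2) ^ S n <= (1 / 2) ^ n) by (pose proof (half_pow_pos n); simpl; lra).
  assert (Hx : K * (1 / 2) ^ S n <= K * (1 / 2) ^ n) by (apply Rmult_le_compat_l; assumption).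
  set (x := K * (1 / 2) ^ n) in *. set (x' := K * (1 / 2) ^ S n) in *.
  replace ((E * K + 2 * E * K) * (1 / 2) ^ n) with (E * x + E * (x + x)) by (unfold x; ring).
  apply Rplus_le_compat.
  - apply Rmult_le_compat; try apply Cmod_ge_0; lra.
  - eapply Rle_trans; [exact H2|]. apply Rmult_le_compat_l; lra.
Qed.

Lemma IFS_eq_slope (n : nat) (z : C) : Cmod z < 1 -> IFS h n z = (z * IFS_slope h q n z 0)%C.
Proof.
  intros Hz. destruct (IFS_slopes (Cmod z)) as [E [HE HF]].
  { split; [apply Cmod_ge_0 | exact Hz]. }
  assert (H0 : Cmod 0 <= Cmod z) by (rewrite Cmod_0; apply Cmod_ge_0).
  pose proof (slopes_eq _ _ _ _ _ (HF n) z 0 (Rle_refl _) H0) as H.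
  rewrite IFS_fixes_0 in H. replace (IFS h n z) with (IFS h n z - 0)%C by ring.
  rewrite H. ring.
Qed.

Lemma IFS_limit_uniform (r : R) : 0 <= r < 1 ->
  exists B, 0 <= B /\ forall n z, Cmod z <= r -> Cmod (IFS h n z - G z) <= B * (1 / 2) ^ n.
Proof.
  intros Hr. destruct (IFS_slope_geom r Hr) as [B [HB H]]. exists B. split; [exact HB|].
  intros n z Hz. change (G z) with (z * Q z 0)%C. rewrite IFS_eq_slope by lra.
  replace (z * IFS_slope h q n z 0 - z * Q z 0)%C
    with (z * (IFS_slope h q n z 0 - Q z 0))%C by ring.
  rewrite Cmod_mult.
  assert (H0 : Cmod 0 <= r) by (rewrite Cmod_0; lra). specialize (H n z 0 Hz H0).
  pose proof (Cmod_ge_0 z). pose proof (Cmod_ge_0 (IFS_slope h q n z 0 - Q z 0)). nra.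
Qed.

Lemma IFS_limit_contracts (z : C) : Cmod z < 1 -> Cmod (G z) <= Cmod z.
Proof.
  intros Hz. destruct (IFS_limit_uniform (Cmod z)) as [B [_ HB]].
  { split; [apply Cmod_ge_0 | exact Hz]. }
  apply (geom_lim_bound (fun n => IFS h n z)).
  - intros n. now apply IFS_contracts.
  - exists B. intros n. apply HB, Rle_refl.
Qed.

(** This is where holomorphy survives the passage to the limit. *)
Lemma IFS_limit_slopes (r : R) : 0 <= r < 1 -> exists E, 0 <= E /\ slopes r E E G Q.
Proof.
  intros Hr. destruct (IFS_slopes r Hr) as [E [HE HF]].
  destruct (IFS_slope_geom r Hr) as [B [_ HB]].
  destruct (IFS_limit_uniform r Hr) as [B' [_ HB']].
  assert (LQ : forall z w, Cmod z <= r -> Cmod w <= r ->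
    geom_lim (fun n => IFS_slope h q n z w) (Q z w)).
  { intros z w Hz Hw. exists B. intros n. now apply HB. }
  assert (LG : forall z, Cmod z <= r -> geom_lim (fun n => IFS h n z) (G z)).
  { intros z Hz. exists B'. intros n. now apply HB'. }
  exists E. split; [exact HE|]. split.
  - intros z w Hz Hw. eapply geom_lim_unique.
    + apply geom_lim_minus; apply LG; assumption.
    + eapply geom_lim_ext; [| apply geom_lim_scal, (LQ z w Hz Hw)].
      intros n. symmetry. now apply (slopes_eq _ _ _ _ _ (HF n)).
  - intros z w Hz Hw. eapply geom_lim_unique; [now apply LQ|].
    eapply geom_lim_ext; [| apply (LQ w z Hw Hz)].
    intros n. now apply (slopes_sym _ _ _ _ _ (HF n)).
  - intros z w Hz Hw. apply (geom_lim_bound _ _ _) with (2 := LQ z w Hz Hw).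
    intros n. now apply (slopes_bound _ _ _ _ _ (HF n)).
  - intros z z' w Hz Hz' Hw.
    apply (geom_lim_bound _ _ _)
      with (2 := geom_lim_minus _ _ _ _ (LQ z w Hz Hw) (LQ z' w Hz' Hw)).
    intros n. now apply (slopes_lip _ _ _ _ _ (HF n)).
Qed.

(** The divided difference of the limit at [(0, 0)] is the infinite product of
    the [q n 0 0], of modulus at least [1 / 2] since the deviations from [1] sum to
    at most [1 / 2].  If the limit vanished identically, its divided
    differences at [(z, 0)] would vanish for [z <> 0], hence by continuity also at
    [(0, 0)]. *)
Lemma IFS_limit_nonconstant :
  (forall n, Cmod (q n 0 0 - 1) <= (1 / 2) ^ n / 4) ->
  exists z, Cmod z < 1 /\ G z <> 0.
Proof.
  intros Hq.
  assert (Hlow : forall n, 1 / 2 <= Cmod (IFS_slope h q n 0 0)).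
  { intros n. apply Rle_trans with (1 - (2 - (1 / 2) ^ n) / 4);
      [pose proof (half_pow_pos n); lra|].
    induction n as [|n IH]; simpl IFS_slope.
    - specialize (Hq 0%nat). pose proof (Cmod_triangle_inv 1 (1 - q 0%nat 0 0)) as H.
      replace (1 - (1 - q 0%nat 0 0))%C with (q 0%nat 0 0) in H by ring.
      rewrite Cmod_1, (Cmod_minus_sym 1) in H. simpl in *. lra.
    - rewrite !contraction_fixes_0, Cmod_mult. specialize (Hq (S n)).
      pose proof (Cmod_triangle_inv 1 (1 - q (S n) 0 0)) as H.
      replace (1 - (1 - q (S n) 0 0))%C with (q (S n) 0 0) in H by ring.
      rewrite Cmod_1, (Cmod_minus_sym 1) in H.
      pose proof (half_pow_pos n). pose proof (half_pow_le_1 n). simpl in *. nra. }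
  apply NNPP. intros Hno.
  assert (HG : forall z, Cmod z < 1 -> G z = 0).
  { intros z Hz. apply NNPP. intros HG. apply Hno. now exists z. }
  destruct (IFS_limit_slopes (1 / 2) ltac:(lra)) as [E [HE HS]].
  destruct (IFS_slope_geom (1 / 2) ltac:(lra)) as [B [_ HB]].
  assert (H0 : Cmod 0 <= 1 / 2) by (rewrite Cmod_0; lra).
  assert (HQ : 1 / 2 <= Cmod (Q 0 0)).
  { apply (geom_lim_lower_bound (fun n => IFS_slope h q n 0 0)); [exact Hlow|].
    exists B. intros n. now apply HB. }
  assert (Cmod (Q 0 0) <= 0); [| lra].
  apply (le_of_le_plus_half_pow _ _ E). intros n.
  (* Points tending to [0]; the shift keeps the first one within the radius [1 / 2]. *)
  set (z := RtoC ((1 / 2) ^ S n)).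
  assert (Hzn : Cmod z = (1 / 2) ^ S n).
  { unfold z. rewrite Cmod_R. apply Rabs_pos_eq, Rlt_le, half_pow_pos. }
  assert (Hz : Cmod z <= 1 / 2).
  { rewrite Hzn. pose proof (half_pow_le_1 n). simpl. lra. }
  assert (Hz0 : z <> 0) by (apply Cmod_gt_0; rewrite Hzn; apply half_pow_pos).
  assert (HQz : Q z 0 = 0).
  { assert (Hzl : Cmod z < 1) by lra. specialize (HG z Hzl). change (G z) with (z * Q z 0)%C in HG.
    replace (Q z 0) with (/ z * (z * Q z 0))%C by (field; exact Hz0).
    rewrite HG. ring. }
  pose proof (slopes_lip _ _ _ _ _ HS 0 z 0 H0 Hz H0) as H.
  rewrite HQz in H. replace (Q 0 0 - 0)%C with (Q 0 0) in H by ring.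
  rewrite (Cmod_minus_sym 0 z) in H. replace (z - 0)%C with z in H by ring.
  rewrite Hzn in H. pose proof (half_pow_pos n). simpl in H. nra.
Qed.

End NearIdentity.

(** * Involutions of the disk *)

Definition mobius (p z : C) : C := ((p - z) / (1 - Cconj p * z))%C.

(** On the diagonal this is the derivative of [mobius p]. *)
Definition mobius_slope (p z w : C) : C :=
  ((p * Cconj p - 1) / ((1 - Cconj p * z) * (1 - Cconj p * w)))%C.

Section Mobius.
Variable p : C.
Hypothesis Hp : Cmod p < 1.

(** The first bound is uniform in [p] and serves for [z] in a fixed smaller disk;
    the second is uniform in [z] and serves on the whole closed disk. *)
Lemma mobius_denom_ge (z : C) :
  Cmod z <= 1 -> 1 - Cmod z <= Cmod (1 - Cconj p * z) /\ 1 - Cmod p <= Cmod (1 - Cconj p * z).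
Proof.
  intros Hz. pose proof (Cmod_triangle_inv 1 (Cconj p * z)) as H.
  rewrite Cmod_1, Cmod_mult, Cmod_conj in H.
  pose proof (Cmod_ge_0 z). pose proof (Cmod_ge_0 p). split; nra.
Qed.

Lemma mobius_denom_pos (z : C) : Cmod z <= 1 -> 0 < Cmod (1 - Cconj p * z).
Proof. intros Hz. destruct (mobius_denom_ge z Hz). lra. Qed.

Lemma mobius_denom_neq_0 (z : C) : Cmod z <= 1 -> (1 - Cconj p * z)%C <> 0.
Proof. intros Hz. now apply Cmod_gt_0, mobius_denom_pos. Qed.

(** The invariance of the hyperbolic density, with denominators cleared. *)
Lemma mobius_identity (z : C) : Cmod z <= 1 ->
  (1 - Cmod (mobius p z) ^ 2) * Cmod (1 - Cconj p * z) ^ 2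
  = (1 - Cmod p ^ 2) * (1 - Cmod z ^ 2).
Proof.
  intros Hz. unfold mobius. rewrite Cmod_div by now apply mobius_denom_neq_0.
  pose proof (mobius_denom_pos z Hz).
  replace ((1 - (Cmod (p - z) / Cmod (1 - Cconj p * z)) ^ 2) * Cmod (1 - Cconj p * z) ^ 2)
    with (Cmod (1 - Cconj p * z) ^ 2 - Cmod (p - z) ^ 2) by (field; lra).
  rewrite !Cmod2_alt. destruct p as [a b], z as [x y]. simpl. ring.
Qed.

Lemma mobius_in_disk (z : C) : Cmod z < 1 -> Cmod (mobius p z) < 1.
Proof.
  intros Hz. pose proof (mobius_identity z ltac:(lra)) as H.
  pose proof (mobius_denom_pos z ltac:(lra)).
  pose proof (Cmod_ge_0 z). pose proof (Cmod_ge_0 p). pose proof (Cmod_ge_0 (mobius p z)).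
  assert (0 < (1 - Cmod p ^ 2) * (1 - Cmod z ^ 2)) by (apply Rmult_lt_0_compat; nra).
  rewrite <- H in *. apply Rnot_le_lt. intros Hge.
  assert (0 <= (Cmod (mobius p z) ^ 2 - 1) * Cmod (1 - Cconj p * z) ^ 2); [| lra].
  apply Rmult_le_pos; [nra | apply pow2_ge_0].
Qed.

Lemma one_minus_pp_neq_0 : (1 - p * Cconj p)%C <> 0.
Proof.
  rewrite Cmult_comm. apply mobius_denom_neq_0. lra.
Qed.

Lemma mobius_involutive (z : C) : Cmod z <= 1 -> mobius p (mobius p z) = z.
Proof.
  intros Hz. unfold mobius.
  pose proof (mobius_denom_neq_0 z Hz) as H. pose proof one_minus_pp_neq_0 as H1.
  field. split; [exact H|].
  replace (1 - Cconj p * z - Cconj p * (p - z))%C with (1 - p * Cconj p)%C by ring.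
  exact H1.
Qed.

Lemma mobius_injective (z w : C) : Cmod z <= 1 -> Cmod w <= 1 ->
  mobius p z = mobius p w -> z = w.
Proof.
  intros Hz Hw H. rewrite <- (mobius_involutive z Hz), <- (mobius_involutive w Hw).
  now rewrite H.
Qed.

Lemma Cmod_pp_minus_1 : Cmod (p * Cconj p - 1) = 1 - Cmod p ^ 2.
Proof.
  rewrite <- Cmod2_conj, Cmod_minus_sym, <- RtoC_minus, Cmod_R.
  apply Rabs_pos_eq. pose proof (Cmod_ge_0 p). nra.
Qed.

Lemma mobius_slopes :
  slopes 1 (2 / (1 - Cmod p)) (2 / (1 - Cmod p) ^ 2) (mobius p) (mobius_slope p).
Proof.
  assert (Hc : 0 < 1 - Cmod p) by lra.
  assert (Hpp : Cmod (p * Cconj p - 1) <= 2 * (1 - Cmod p)).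
  { rewrite Cmod_pp_minus_1. pose proof (Cmod_ge_0 p). nra. }
  split.
  - intros z w Hz Hw. unfold mobius, mobius_slope. field.
    split; now apply mobius_denom_neq_0.
  - intros z w Hz Hw. unfold mobius_slope. now rewrite (Cmult_comm (1 - Cconj p * z)).
  - intros z w Hz Hw. unfold mobius_slope.
    pose proof (mobius_denom_neq_0 z Hz) as Ha. pose proof (mobius_denom_neq_0 w Hw) as Hb.
    rewrite Cmod_div by now apply Cmult_neq_0.
    rewrite Cmod_mult.
    destruct (mobius_denom_ge z Hz) as [_ H1]. destruct (mobius_denom_ge w Hw) as [_ H2].
    replace (2 / (1 - Cmod p)) with (2 * (1 - Cmod p) * / ((1 - Cmod p) * (1 - Cmod p)))
      by (field; lra).
    apply Rmult_le_compat; [apply Cmod_ge_0 | | exact Hpp |].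
    + apply Rlt_le, Rinv_0_lt_compat, Rmult_lt_0_compat; lra.
    + apply Rinv_le_contravar; [nra | apply Rmult_le_compat; lra].
  - intros z z' w Hz Hz' Hw. unfold mobius_slope.
    pose proof (mobius_denom_neq_0 z Hz) as Ha.
    pose proof (mobius_denom_neq_0 z' Hz') as Ha'.
    pose proof (mobius_denom_neq_0 w Hw) as Hb.
    replace ((p * Cconj p - 1) / ((1 - Cconj p * z) * (1 - Cconj p * w))
             - (p * Cconj p - 1) / ((1 - Cconj p * z') * (1 - Cconj p * w)))%C
      with ((p * Cconj p - 1) * Cconj p
            / ((1 - Cconj p * z) * (1 - Cconj p * z') * (1 - Cconj p * w)) * (z - z'))%C
      by (field; auto).
    rewrite Cmod_mult. apply Rmult_le_compat_r; [apply Cmod_ge_0|].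
    rewrite Cmod_div by (repeat apply Cmult_neq_0; assumption).
    rewrite !Cmod_mult, Cmod_conj.
    destruct (mobius_denom_ge z Hz) as [_ H1]. destruct (mobius_denom_ge w Hw) as [_ H2].
    destruct (mobius_denom_ge z' Hz') as [_ H3].
    replace (2 / (1 - Cmod p) ^ 2)
      with (2 * (1 - Cmod p) * 1 * / ((1 - Cmod p) * (1 - Cmod p) * (1 - Cmod p)))
      by (field; lra).
    apply Rmult_le_compat.
    + apply Rmult_le_pos; apply Cmod_ge_0.
    + apply Rlt_le, Rinv_0_lt_compat; repeat apply Rmult_lt_0_compat; lra.
    + apply Rmult_le_compat; try apply Cmod_ge_0; lra.
    + apply Rinv_le_contravar; [repeat apply Rmult_lt_0_compat; lra|].
      repeat apply Rmult_le_compat; try lra. apply Rmult_le_pos; lra.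
Qed.

(** * Blaschke products of degree two *)

(** The rotation that makes [phase * mobius p z] tend to [1], rather than to some
    other point of the circle, when [p] tends to the circle: at [z = 0] its value
    is [|p|]. *)
Definition phase : C := (Cconj p / Cmod p)%C.
Definition blaschke2 (t : R) (z : C) : C := (t * (phase * (z * mobius p z)))%C.
(** Comes from writing [phase * mobius p z] as
    [1 - (1 - |p|) * (1 + phase * z) / (1 - conj p * z)], which shows the deviation
    from the identity with its small factor [1 - |p|]. *)
Definition blaschke2_slope (t : R) (z w : C) : C :=
  (t * (1 - (1 - Cmod p) *
     ((1 + phase * (z + w) - phase * Cconj p * z * w)
      / ((1 - Cconj p * z) * (1 - Cconj p * w)))))%C.

Hypothesis Hp0 : 0 < Cmod p.

Lemma Cmod_p_neq_0 : RtoC (Cmod p) <> 0.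
Proof. intros H. apply RtoC_inj in H. lra. Qed.

Lemma Cmod_phase : Cmod phase = 1.
Proof.
  unfold phase. rewrite Cmod_div by apply Cmod_p_neq_0.
  rewrite Cmod_conj, Cmod_R, Rabs_pos_eq by lra. field; lra.
Qed.

Lemma phase_conj : (Cconj p = phase * Cmod p)%C.
Proof. unfold phase. field. apply Cmod_p_neq_0. Qed.

Lemma phase_p : (phase * p = Cmod p)%C.
Proof.
  unfold phase. replace (Cconj p / Cmod p * p)%C with ((p * Cconj p) / Cmod p)%C
    by (field; apply Cmod_p_neq_0).
  rewrite <- Cmod2_conj, RtoC_pow. field. apply Cmod_p_neq_0.
Qed.

(** The involution swaps the two factors [z] and [mobius p z]. *)
Lemma blaschke2_mobius (t : R) (z : C) : Cmod z <= 1 ->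
  blaschke2 t (mobius p z) = blaschke2 t z.
Proof. intros Hz. unfold blaschke2. rewrite mobius_involutive by exact Hz. ring. Qed.

Lemma blaschke2_lt (t : R) (z : C) : 0 < t <= 1 -> Cmod z < 1 ->
  Cmod (blaschke2 t z) < t /\ Cmod (blaschke2 t z) <= Cmod z.
Proof.
  intros Ht Hz. unfold blaschke2.
  rewrite !Cmod_mult, Cmod_phase, Cmod_R, Rabs_pos_eq by lra.
  pose proof (mobius_in_disk z Hz). pose proof (Cmod_ge_0 z).
  pose proof (Cmod_ge_0 (mobius p z)).
  assert (Cmod z * Cmod (mobius p z) <= Cmod z) by nra.
  assert (0 <= Cmod z * Cmod (mobius p z)) by (apply Rmult_le_pos; assumption).
  split; nra.
Qed.

Lemma blaschke2_slope_near_1 (t e r : R) :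
  1 - e <= t <= 1 -> 1 - e <= Cmod p -> 0 <= e <= 1 -> 0 <= r < 1 ->
  forall z w, Cmod z <= r -> Cmod w <= r ->
    Cmod (blaschke2_slope t z w - 1) <= 5 / (1 - r) ^ 3 * e.
Proof.
  intros Ht Hpe He Hr z w Hz Hw. unfold blaschke2_slope.
  set (a := (1 - Cconj p * z)%C). set (b := (1 - Cconj p * w)%C).
  set (N := (1 + phase * (z + w) - phase * Cconj p * z * w)%C).
  assert (Ha : 1 - r <= Cmod a) by (destruct (mobius_denom_ge z ltac:(lra)); unfold a; lra).
  assert (Hb : 1 - r <= Cmod b) by (destruct (mobius_denom_ge w ltac:(lra)); unfold b; lra).
  assert (Ha0 : a <> 0) by (apply Cmod_gt_0; lra).
  assert (Hb0 : b <> 0) by (apply Cmod_gt_0; lra).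
  assert (HN : Cmod N <= 4).
  { unfold N. eapply Rle_trans; [apply Cmod_triangle_minus|].
    pose proof (Cmod_triangle 1 (phase * (z + w))) as H1.
    pose proof (Cmod_triangle z w) as H2.
    rewrite !Cmod_mult, Cmod_phase, Cmod_conj. rewrite Cmod_mult, Cmod_phase, Cmod_1 in H1.
    pose proof (Cmod_ge_0 z). pose proof (Cmod_ge_0 w). pose proof (Cmod_ge_0 p).
    assert (0 <= Cmod p * Cmod z <= 1) by (split; nra).
    assert (1 * Cmod p * Cmod z * Cmod w <= 1) by nra. lra. }
  replace (t * (1 - (1 - Cmod p) * (N / (a * b))) - 1)%C
    with ((t - 1) - t * (1 - Cmod p) * (N / (a * b)))%C by ring.
  eapply Rle_trans; [apply Cmod_triangle_minus|].
  rewrite !Cmod_mult, Cmod_div, Cmod_mult by now apply Cmult_neq_0.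
  rewrite <- !RtoC_minus, !Cmod_R, (Rabs_minus_sym t 1), !Rabs_pos_eq by lra.
  set (s := 1 - r) in *. assert (Hs : 0 < s <= 1) by (unfold s; lra).
  assert (HW : Cmod N / (Cmod a * Cmod b) <= 4 / s ^ 3).
  { apply Rmult_le_compat; [apply Cmod_ge_0 | | exact HN |].
    - apply Rlt_le, Rinv_0_lt_compat, Rmult_lt_0_compat; lra.
    - apply Rinv_le_contravar; [apply pow_lt; lra|].
      apply Rle_trans with (s * s); [simpl; nra | apply Rmult_le_compat; lra]. }
  assert (HW0 : 0 <= Cmod N / (Cmod a * Cmod b)).
  { apply Rmult_le_pos; [apply Cmod_ge_0|].
    apply Rlt_le, Rinv_0_lt_compat, Rmult_lt_0_compat; lra. }
  assert (Hs3 : 1 <= 1 / s ^ 3).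
  { unfold Rdiv. rewrite Rmult_1_l, <- Rinv_1 at 1.
    apply Rinv_le_contravar; [apply pow_lt; lra | simpl; nra]. }
  replace (5 / s ^ 3 * e) with (1 / s ^ 3 * e + 1 * e * (4 / s ^ 3)) by (field; lra).
  apply Rplus_le_compat; [nra|].
  apply Rmult_le_compat; [nra | exact HW0 | nra | exact HW].
Qed.

Lemma blaschke2_slopes (t e r : R) :
  0 <= t -> 1 - e <= t <= 1 -> 1 - e <= Cmod p -> 0 <= e <= 1 -> 0 <= r < 1 ->
  slopes r (1 + 5 / (1 - r) ^ 3 * e) (5 / (1 - r) ^ 3 * e) (blaschke2 t) (blaschke2_slope t).
Proof.
  intros Ht0 Ht Hpe He Hr.
  assert (HD : forall z, Cmod z <= r ->
    (1 - Cconj p * z)%C <> 0 /\ 1 - r <= Cmod (1 - Cconj p * z)).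
  { intros z Hz. split; [apply mobius_denom_neq_0; lra|].
    destruct (mobius_denom_ge z ltac:(lra)); lra. }
  split.
  - intros z w Hz Hw. destruct (HD z Hz) as [Hz0 _]. destruct (HD w Hw) as [Hw0 _].
    assert (HU : forall y, (1 - Cconj p * y)%C <> 0 -> blaschke2 t y =
      (t * (y * (1 - (1 - Cmod p) * ((1 + phase * y) / (1 - Cconj p * y)))))%C).
    { intros y Hy. unfold blaschke2, mobius.
      replace (phase * (y * ((p - y) / (1 - Cconj p * y))))%C
        with (y * ((phase * p - phase * y) / (1 - Cconj p * y)))%C by (field; exact Hy).
      rewrite phase_p. f_equal. f_equal. rewrite phase_conj in *. field. exact Hy. }
    rewrite !HU by assumption. unfold blaschke2_slope. field. auto.
  - intros z w Hz Hw. unfold blaschke2_slope.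
    rewrite (Cmult_comm (1 - Cconj p * z)).
    replace (phase * Cconj p * z * w)%C with (phase * Cconj p * w * z)%C by ring.
    now rewrite (Cplus_comm z w).
  - intros z w Hz Hw.
    pose proof (blaschke2_slope_near_1 t e r Ht Hpe He Hr z w Hz Hw).
    pose proof (Cmod_triangle (blaschke2_slope t z w - 1) 1) as H1.
    replace (blaschke2_slope t z w - 1 + 1)%C with (blaschke2_slope t z w) in H1 by ring.
    rewrite Cmod_1 in H1. lra.
  - intros z z' w Hz Hz' Hw. unfold blaschke2_slope.
    destruct (HD z Hz) as [Hz0 Hz1]. destruct (HD w Hw) as [Hw0 Hw1].
    destruct (HD z' Hz') as [Hz0' Hz1'].
    match goal with |- Cmod ?X <= _ => replace X with
      (t * ((Cmod p - 1) * ((phase + Cconj p)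
        / ((1 - Cconj p * z) * (1 - Cconj p * z') * (1 - Cconj p * w)))) * (z - z'))%C
      by (field; auto) end.
    rewrite Cmod_mult. apply Rmult_le_compat_r; [apply Cmod_ge_0|].
    rewrite !Cmod_mult, Cmod_div, !Cmod_mult by (repeat apply Cmult_neq_0; assumption).
    rewrite <- RtoC_minus, !Cmod_R, (Rabs_minus_sym (Cmod p)), !Rabs_pos_eq by lra.
    pose proof (Cmod_triangle phase (Cconj p)) as H2. rewrite Cmod_phase, Cmod_conj in H2.
    set (s := 1 - r) in *. assert (Hs : 0 < s <= 1) by (unfold s; lra).
    replace (5 / s ^ 3 * e) with (1 * (e * (5 / s ^ 3))) by (field; lra).
    assert (HW0 : 0 <= / (Cmod (1 - Cconj p * z) * Cmod (1 - Cconj p * z') * Cmod (1 - Cconj p * w))).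
    { apply Rlt_le, Rinv_0_lt_compat; repeat apply Rmult_lt_0_compat; lra. }
    apply Rmult_le_compat; [lra | | lra |].
    + apply Rmult_le_pos; [lra | apply Rmult_le_pos; [apply Cmod_ge_0 | exact HW0]].
    + apply Rmult_le_compat; [lra | apply Rmult_le_pos; [apply Cmod_ge_0 | exact HW0] | lra |].
      apply Rmult_le_compat; [apply Cmod_ge_0 | exact HW0 | lra |].
      apply Rinv_le_contravar; [apply pow_lt; lra|].
      replace (s ^ 3) with (s * s * s) by ring.
      repeat apply Rmult_le_compat; try lra. apply Rmult_le_pos; lra.
Qed.

Lemma blaschke2_slope_0 (t e : R) : 1 - e <= t <= 1 -> 1 - e <= Cmod p ->
  Cmod (blaschke2_slope t 0 0 - 1) <= 2 * e.
Proof.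
  intros Ht Hpe. unfold blaschke2_slope.
  match goal with |- Cmod ?X <= _ => replace X with (RtoC (t * Cmod p - 1)) end.
  - rewrite Cmod_R, Rabs_minus_sym, Rabs_pos_eq; nra.
  - rewrite RtoC_minus, RtoC_mult. rewrite !Cmult_0_r, Cplus_0_r.
    field.
Qed.

End Mobius.

(** * Hyperbolic disks *)

Lemma rho_dist_le (z w : C) (gamma dgamma : R -> C) (L : R) :
  C1_path gamma dgamma z w -> rho_length gamma dgamma <= L -> 0 <= L ->
  rho_dist z w <= L.
Proof.
  intros Hg HL H0. unfold rho_dist.
  match goal with |- real (Glb_Rbar ?E) <= _ => destruct (Glb_Rbar_correct E) as [Hlb _];
    specialize (Hlb (rho_length gamma dgamma) (ex_intro _ gamma (ex_intro _ dgamma (conj Hg eq_refl))));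
    destruct (Glb_Rbar E) end; simpl in *; lra || tauto.
Qed.

Lemma is_derive_of_quadratic (gamma : R -> C) (s d M : R) (l : C) :
  0 < d ->
  (forall s', Rabs (s' - s) < d ->
     Cmod (gamma s' - gamma s - RtoC (s' - s) * l) <= M * Rabs (s' - s) ^ 2) ->
  @is_derive R_AbsRing C_R_NormedModule gamma s l.
Proof.
  intros Hd H. split; [apply is_linear_scal_l|].
  intros x Hx. apply (@is_filter_lim_locally_unique R_AbsRing (AbsRing_NormedModule R_AbsRing) s x) in Hx.
  subst x. intros eps. set (K := Rabs M + 1).
  assert (HK : 0 < K) by (unfold K; pose proof (Rabs_pos M); lra).
  assert (Hd' : 0 < Rmin d (eps / K)).
  { apply Rmin_pos; [lra | apply Rdiv_lt_0_compat; [apply eps | exact HK]]. }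
  exists (mkposreal _ Hd'). intros y Hy.
  change (Rabs (y - s) < Rmin d (eps / K)) in Hy.
  pose proof (Rmin_l d (eps / K)). pose proof (Rmin_r d (eps / K)).
  specialize (H y ltac:(lra)).
  rewrite <- Cmod_norm. change (norm (minus y s)) with (Rabs (y - s)).
  match goal with |- Cmod ?X <= _ =>
    replace X with (gamma y - gamma s - RtoC (y - s) * l)%C end.
  - eapply Rle_trans; [exact H|]. pose proof (Rabs_pos (y - s)). pose proof (Rle_abs M).
    assert (K * Rabs (y - s) <= eps).
    { apply Rle_trans with (K * (eps / K)); [apply Rmult_le_compat_l; lra | right; field; lra]. }
    assert (M * Rabs (y - s) <= eps) by (unfold K in *; nra).
    simpl. nra.
  - change (minus y s) with (y - s). unfold minus.
    replace (@scal R_AbsRing C_R_NormedModule (y - s) l) with (RtoC (y - s) * l)%C;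
      [reflexivity|].
    destruct l. unfold Cmult, RtoC; simpl.
    change (@scal R_AbsRing C_R_NormedModule (y - s) (r, r0)) with ((y - s) * r, (y - s) * r0).
    f_equal; ring.
Qed.

Lemma continuous_of_lipschitz (g : R -> C) (s d M : R) :
  0 < d ->
  (forall s', Rabs (s' - s) < d -> Cmod (g s' - g s) <= M * Rabs (s' - s)) ->
  @continuous R_UniformSpace C_UniformSpace g s.
Proof.
  intros Hd H. apply filterlim_locally. intros eps. set (K := Rabs M + 1).
  assert (HK : 0 < K) by (unfold K; pose proof (Rabs_pos M); lra).
  assert (Hd' : 0 < Rmin d (eps / K)).
  { apply Rmin_pos; [lra | apply Rdiv_lt_0_compat; [apply eps | exact HK]]. }
  exists (mkposreal _ Hd'). intros y Hy.
  change (Rabs (y - s) < Rmin d (eps / K)) in Hy.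
  pose proof (Rmin_l d (eps / K)). pose proof (Rmin_r d (eps / K)).
  specialize (H y ltac:(lra)).
  apply C_NormedModule_mixin_compat1. change (Cmod (g y - g s) < eps).
  eapply Rle_lt_trans; [exact H|].
  pose proof (Rabs_pos (y - s)). pose proof (Rle_abs M).
  apply Rle_lt_trans with (K * Rabs (y - s)); [unfold K; nra|].
  apply Rlt_le_trans with (K * (eps / K)); [apply Rmult_lt_compat_l; lra | right; field; lra].
Qed.

(** The radius [s -> A_p ((1 - s) w)] joins the two points, and by invariance of
    the density it has the length of the Euclidean radius from [w] to [0], which
    is at most [1 / (1 - t^2)].  A bound independent of [p] is all that is needed,
    so the exact distance is not computed. *)
Lemma rho_dist_mobius_le (p w : C) (t : R) :
  Cmod p < 1 -> Cmod w <= t -> t < 1 -> rho_dist (mobius p w) p <= 1 / (1 - t ^ 2).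
Proof.
  intros Hp Hwt Ht.
  pose proof (Cmod_ge_0 w) as Hw0.
  set (ray s := (RtoC (1 - s) * w)%C).
  set (gamma s := mobius p (ray s)).
  set (dgamma s := (- w * mobius_slope p (ray s) (ray s))%C).
  assert (Hray : forall s s', (ray s' - ray s)%C = (- (RtoC (s' - s) * w))%C).
  { intros s s'. unfold ray. rewrite !RtoC_minus. ring. }
  assert (Hrm : forall s, 0 <= s <= 1 -> Cmod (ray s) <= t).
  { intros s Hs. unfold ray. rewrite Cmod_mult, Cmod_R, Rabs_pos_eq by lra. nra. }
  (* Derivatives are two-sided, so the ray is also followed a little beyond the
     endpoints, where it must stay in the closed disk. *)
  assert (Hnear : forall s s', 0 <= s <= 1 -> Rabs (s' - s) < 1 - t -> Cmod (ray s') <= 1).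
  { intros s s' Hs Hd. unfold ray. rewrite Cmod_mult, Cmod_R.
    assert (Rabs (1 - s') <= 2 - t) by (apply Rabs_def2 in Hd; apply Rabs_le; lra).
    pose proof (Rabs_pos (1 - s')). nra. }
  pose proof (mobius_slopes p Hp) as HS. set (M := 2 / (1 - Cmod p) ^ 2) in HS.
  assert (HM : 0 <= M).
  { unfold M. apply Rlt_le, Rdiv_lt_0_compat; [lra | apply pow_lt; lra]. }
  assert (Hbd : 0 <= 1 / (1 - t ^ 2)).
  { apply Rlt_le, Rdiv_lt_0_compat; simpl; nra. }
  apply (rho_dist_le _ _ gamma dgamma); [| | exact Hbd].
  - split; [|split].
    + unfold gamma, ray. f_equal. rewrite Rminus_0_r. ring.
    + unfold gamma, ray, mobius. rewrite Rminus_diag.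
      rewrite Cmult_0_l, Cmult_0_r. field.
    + intros s Hs. pose proof (Hrm s Hs) as Hrs. split; [|split].
      * apply mobius_in_disk; [exact Hp | lra].
      * apply (is_derive_of_quadratic _ _ (1 - t) M); [lra|]. intros s' Hd.
        pose proof (Hnear s s' Hs Hd) as Hrs'. unfold gamma, dgamma.
        rewrite (slopes_eq _ _ _ _ _ HS) by lra. rewrite Hray.
        replace (- (RtoC (s' - s) * w) * mobius_slope p (ray s') (ray s)
                 - RtoC (s' - s) * (- w * mobius_slope p (ray s) (ray s)))%C
          with (- (RtoC (s' - s) * w)
                * (mobius_slope p (ray s') (ray s) - mobius_slope p (ray s) (ray s)))%C
          by ring.
        rewrite Cmod_mult, Cmod_opp, Cmod_mult, Cmod_R.
        pose proof (slopes_lip _ _ _ _ _ HS (ray s') (ray s) (ray s)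
          ltac:(lra) ltac:(lra) ltac:(lra)) as Hl.
        rewrite Hray, Cmod_opp, Cmod_mult, Cmod_R in Hl.
        pose proof (Rabs_pos (s' - s)) as Ha.
        assert (Rabs (s' - s) * Cmod w <= Rabs (s' - s)) by nra.
        replace (M * Rabs (s' - s) ^ 2) with (Rabs (s' - s) * (M * Rabs (s' - s))) by ring.
        apply Rmult_le_compat; [nra | apply Cmod_ge_0 | assumption |].
        eapply Rle_trans; [exact Hl | now apply Rmult_le_compat_l].
      * apply (continuous_of_lipschitz _ _ (1 - t) (M * 2)); [lra|]. intros s' Hd.
        pose proof (Hnear s s' Hs Hd) as Hrs'. unfold dgamma.
        replace (- w * mobius_slope p (ray s') (ray s') - - w * mobius_slope p (ray s) (ray s))%C
          with (- w * (mobius_slope p (ray s') (ray s') - mobius_slope p (ray s) (ray s)))%C by ring.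
        rewrite Cmod_mult, Cmod_opp.
        pose proof (slopes_lip2 _ _ _ _ _ HS (ray s') (ray s) (ray s') (ray s)
          ltac:(lra) ltac:(lra) ltac:(lra) ltac:(lra)) as Hl.
        rewrite Hray, Cmod_opp, Cmod_mult, Cmod_R in Hl.
        pose proof (Rabs_pos (s' - s)) as Ha.
        assert (Rabs (s' - s) * Cmod w <= Rabs (s' - s)) by nra.
        pose proof (Cmod_ge_0 (mobius_slope p (ray s') (ray s') - mobius_slope p (ray s) (ray s))).
        apply Rle_trans with (1 * (M * (Rabs (s' - s) * Cmod w + Rabs (s' - s) * Cmod w)));
          [apply Rmult_le_compat; lra | nra].
  - unfold rho_length.
    rewrite (RInt_ext _ (fun s => Cmod w / (1 - ((1 - s) * Cmod w) ^ 2))).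
    + apply Rle_trans with (RInt (fun _ => 1 / (1 - t ^ 2)) 0 1).
      * apply RInt_le; [lra | | apply ex_RInt_const |].
        -- apply (ex_RInt_continuous (V := R_CompleteNormedModule)). intros s Hs.
           rewrite Rmin_left, Rmax_right in Hs by lra.
           apply (ex_derive_continuous (V := R_NormedModule)). auto_derive.
           assert (0 <= (1 - s) * Cmod w <= t) by (split; nra). apply Rgt_not_eq. nra.
        -- intros s Hs. assert (0 <= (1 - s) * Cmod w <= t) by (split; nra).
           apply Rmult_le_compat; [exact Hw0 | | lra |].
           ++ apply Rlt_le, Rinv_0_lt_compat. nra.
           ++ apply Rinv_le_contravar; [nra|].
              apply Rplus_le_compat_l, Ropp_le_contravar, pow_incr. assumption.
      * rewrite RInt_const. change (scal (1 - 0) (1 / (1 - t ^ 2)))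
          with ((1 - 0) * (1 / (1 - t ^ 2))). lra.
    + intros s Hs. rewrite Rmin_left, Rmax_right in Hs by lra.
      pose proof (Hrm s ltac:(lra)) as Hrs.
      unfold rho_density, gamma, dgamma, mobius_slope.
      pose proof (mobius_identity p Hp (ray s) ltac:(lra)) as Hid.
      pose proof (mobius_denom_pos p Hp (ray s) ltac:(lra)) as HDp.
      pose proof (mobius_denom_neq_0 p Hp (ray s) ltac:(lra)) as HD.
      pose proof (mobius_in_disk p Hp (ray s) ltac:(lra)) as Hin.
      rewrite Cmod_mult, Cmod_opp, Cmod_div, Cmod_mult, Cmod_pp_minus_1
        by (assumption || now apply Cmult_neq_0).
      assert (Hry : Cmod (ray s) = (1 - s) * Cmod w).
      { unfold ray. rewrite Cmod_mult, Cmod_R, Rabs_pos_eq by lra. reflexivity. }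
      rewrite <- Hry.
      pose proof (Cmod_ge_0 (mobius p (ray s))). pose proof (Cmod_ge_0 (ray s)).
      pose proof (Cmod_ge_0 p).
      set (D := Cmod (1 - Cconj p * ray s)) in *.
      set (m := Cmod (mobius p (ray s))) in *. set (y := Cmod (ray s)) in *.
      assert (0 < 1 - m ^ 2) by (simpl; nra). assert (0 < 1 - y ^ 2) by (simpl; nra).
      assert (E : 1 - Cmod p ^ 2 = (1 - m ^ 2) * D ^ 2 / (1 - y ^ 2)).
      { rewrite Hid. field. lra. }
      change (/ (1 - m ^ 2) * (Cmod w * ((1 - Cmod p ^ 2) / (D * D))) = Cmod w / (1 - y ^ 2)).
      rewrite E. field. lra.
Qed.

Lemma non_Bloch_disk (X : C -> Prop) (t : R) :
  ~ rho_Bloch X -> 0 <= t < 1 ->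
  exists p, Cmod p < 1 /\ forall w, Cmod w <= t -> X (mobius p w).
Proof.
  intros HB Ht. apply NNPP. intros Hno. apply HB.
  unfold rho_Bloch. set (bd := 1 / (1 - t ^ 2)).
  apply Rbar_le_lt_trans with (Finite bd); [| exact I].
  unfold Bloch_radius. apply Lub_Rbar_correct. intros r [Hr [p [Hp HX]]]. simpl.
  apply Rnot_lt_le. intros Hlt. apply Hno. exists p. split; [exact Hp|].
  intros w Hw. apply HX. split.
  - apply mobius_in_disk; [exact Hp | lra].
  - pose proof (rho_dist_mobius_le p w t Hp Hw ltac:(lra)). fold bd in H. lra.
Qed.

(** If [X] is the whole disk any centre will do.  Otherwise a point [x] outside
    [X] is missed by the image of the disk of radius [t], so [|A_p x| > t], and
    [mobius_identity] at [x] bounds [1 - |p|^2] by a multiple of [1 - t^2]. *)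
Lemma non_Bloch_disk_near_boundary (X : C -> Prop) (e : R) :
  ~ rho_Bloch X -> 0 < e < 1 ->
  exists p, 1 - e <= Cmod p < 1 /\ forall w, Cmod w < 1 - e -> X (mobius p w).
Proof.
  intros HB He. destruct (classic (forall x, Cmod x < 1 -> X x)) as [Hall | Hx].
  - exists (RtoC (1 - e)). rewrite Cmod_R, Rabs_pos_eq by lra. split; [lra|].
    intros w Hw. apply Hall, mobius_in_disk; [rewrite Cmod_R, Rabs_pos_eq; lra | lra].
  - apply not_all_ex_not in Hx as [x Hx]. apply imply_to_and in Hx as [Hx HXx].
    pose proof (Cmod_ge_0 x) as Hx0.
    set (k := (1 - Cmod x ^ 2) / 4).
    assert (Hk : 0 < k <= 1 / 4) by (unfold k; split; nra).
    (* With this [t] the identity gives [(1 - |p|^2) * 4 k <= (1 - t^2) * 4 <= 4 e k]. *)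
    set (t := 1 - e * k / 2).
    assert (Ht : 1 - e <= t < 1) by (unfold t; split; nra).
    destruct (non_Bloch_disk X t HB ltac:(lra)) as [p [Hp HX]].
    exists p. split; [split; [|exact Hp] | intros w Hw; apply HX; lra].
    assert (Hm : t < Cmod (mobius p x)).
    { apply Rnot_le_lt. intros Hle. apply HXx.
      rewrite <- (mobius_involutive p Hp x) by lra. now apply HX. }
    pose proof (mobius_identity p Hp x ltac:(lra)) as Hid.
    assert (HD : Cmod (1 - Cconj p * x) <= 2).
    { pose proof (Cmod_triangle_minus 1 (Cconj p * x)) as H.
      rewrite Cmod_1, Cmod_mult, Cmod_conj in H. pose proof (Cmod_ge_0 p). nra. }
    assert (HD2 : Cmod (1 - Cconj p * x) ^ 2 <= 4).
    { pose proof (Cmod_ge_0 (1 - Cconj p * x)). simpl. nra. }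
    pose proof (mobius_in_disk p Hp x Hx) as Hm1.
    assert (H1 : 0 <= 1 - Cmod (mobius p x) ^ 2 <= e * k).
    { split; [simpl; nra|]. unfold t in *.
      assert (0 < e * k) by nra. assert (e * k <= 1) by nra. simpl; nra. }
    assert (H2 : (1 - Cmod p ^ 2) * (4 * k) <= e * k * 4).
    { replace (4 * k) with (1 - Cmod x ^ 2) by (unfold k; field). rewrite <- Hid.
      apply Rmult_le_compat; [lra | apply pow2_ge_0 | lra | exact HD2]. }
    assert (1 - Cmod p ^ 2 <= e) by nra.
    pose proof (Cmod_ge_0 p). nra.
Qed.

(** * Compact subsets of the disk *)

Lemma open_disk (r : R) : open ((fun z => Cmod z < r) : C_UniformSpace -> Prop).
Proof.
  intros z Hz. assert (Hd : 0 < (r - Cmod z) / 2) by lra.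
  exists (mkposreal _ Hd). intros y Hy.
  apply C_NormedModule_mixin_compat2 in Hy. simpl in Hy.
  change (minus y z) with (y - z)%C in Hy.
  pose proof (Cmod_triangle_inv y z). pose proof sqrt2_neq_0.
  assert (sqrt 2 <= 2).
  { rewrite <- (sqrt_square 2) at 2 by lra. apply sqrt_le_1_alt. lra. }
  nra.
Qed.

(** Finitely many of the disks of radius [1 - 2^-n] cover the compact set. *)
Lemma compact_in_smaller_disk (K : C -> Prop) :
  compact_set (K : C_UniformSpace -> Prop) -> (forall z, K z -> Cmod z < 1) ->
  exists r, 0 <= r < 1 /\ forall z, K z -> Cmod z <= r.
Proof.
  intros HK Hsub.
  destruct (HK nat (fun n z => Cmod z < 1 - (1 / 2) ^ n)) as [l Hl].
  - intros n. apply open_disk.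
  - intros z Hz. destruct (half_pow_small (1 - Cmod z)) as [N HN].
    + specialize (Hsub z Hz). lra.
    + exists N. specialize (HN N (Nat.le_refl N)). lra.
  - assert (Hmax : exists r, 0 <= r < 1 /\ forall n, In n l -> 1 - (1 / 2) ^ n <= r).
    { clear Hl. induction l as [|a l [r [Hr IH]]].
      - exists 0. split; [lra|]. intros n [].
      - exists (Rmax r (1 - (1 / 2) ^ a)). split.
        + pose proof (Rmax_l r (1 - (1 / 2) ^ a)).
          split; [lra|]. apply Rmax_lub_lt; [lra|]. pose proof (half_pow_pos a). lra.
        + intros n [<- | Hn]; [apply Rmax_r|].
          eapply Rle_trans; [now apply IH | apply Rmax_l]. }
    destruct Hmax as [r [Hr Hmax]]. exists r. split; [exact Hr|].
    intros z Hz. destruct (Hl z Hz) as [n [Hn Hzn]]. specialize (Hmax n Hn). simpl in Hzn. lra.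
Qed.

(** * The iterated function system *)

(** Each [mobius (p (S n))] is applied just before [h n], which absorbs it; only
    the outermost one is left. *)
Lemma IFS_cancel_mobius (p : nat -> C) (h : nat -> C -> C) :
  (forall n, Cmod (p n) < 1) ->
  (forall n z, Cmod z < 1 -> Cmod (h n z) < 1) ->
  (forall n z, Cmod z < 1 -> h n (mobius (p (S n)) z) = h n z) ->
  forall n z, Cmod z < 1 ->
    IFS (fun k y => mobius (p k) (h k y)) n z = mobius (p O) (IFS h n z).
Proof.
  intros Hp Hh Hinv n. induction n as [|n IH]; intros z Hz; [reflexivity|].
  simpl. rewrite IH by (apply mobius_in_disk; auto). f_equal.
  destruct n; simpl; now rewrite Hinv by auto.
Qed.

Theorem theorem1p3 (X : C -> Prop) (hX : subdomain X) (hB : ~ rho_Bloch X) :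
  ~ degenerate X.
Proof.
  set (e := fun n => (1 / 2) ^ n / 8).
  assert (He : forall n, 0 < e n < 1).
  { intros n. unfold e. pose proof (half_pow_pos n). pose proof (half_pow_le_1 n). lra. }
  assert (Hex : forall n, exists p, 1 - e n <= Cmod p < 1 /\
    forall w, Cmod w < 1 - e n -> X (mobius p w)).
  { intros n. now apply non_Bloch_disk_near_boundary. }
  set (p := fun n => proj1_sig (constructive_indefinite_description _ (Hex n))).
  assert (Hp : forall n, 1 - e n <= Cmod (p n) < 1 /\
    forall w, Cmod w < 1 - e n -> X (mobius (p n) w)).
  { intros n. unfold p. now destruct (constructive_indefinite_description _ (Hex n)). }
  clearbody p. clear Hex.
  assert (Hp1 : forall n, 0 < Cmod (p n) < 1).
  { intros n. destruct (Hp n) as [H _]. specialize (He n). lra. }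
  (* [h n] involves the next centre, whose bound [e (S n)] is the smaller one. *)
  assert (HpS : forall n, 1 - e n <= Cmod (p (S n))).
  { intros n. destruct (Hp (S n)) as [H _]. pose proof (half_pow_pos n). unfold e in *.
    simpl in H. lra. }
  set (h := fun n => blaschke2 (p (S n)) (1 - e n)).
  set (q := fun n => blaschke2_slope (p (S n)) (1 - e n)).
  assert (Hlt : forall n z, Cmod z < 1 -> Cmod (h n z) < 1 - e n /\ Cmod (h n z) <= Cmod z).
  { intros n z Hz. specialize (Hp1 (S n)). specialize (He n).
    apply blaschke2_lt; lra. }
  assert (Hcontr : forall n z, Cmod z < 1 -> Cmod (h n z) <= Cmod z).
  { intros n z Hz. now apply Hlt. }
  assert (Hsl : forall r, 0 <= r < 1 -> exists K, 0 <= K /\ forall n,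
    slopes r (1 + K * (1 / 2) ^ n) (K * (1 / 2) ^ n) (h n) (q n) /\
    forall z w, Cmod z <= r -> Cmod w <= r -> Cmod (q n z w - 1) <= K * (1 / 2) ^ n).
  { intros r Hr. exists (5 / (1 - r) ^ 3 / 8). split.
    - apply Rlt_le. assert (0 < (1 - r) ^ 3) by (apply pow_lt; lra).
      repeat apply Rdiv_lt_0_compat; lra.
    - intros n. replace (5 / (1 - r) ^ 3 / 8 * (1 / 2) ^ n) with (5 / (1 - r) ^ 3 * e n)
        by (unfold e; field; lra).
      specialize (Hp1 (S n)). specialize (He n). specialize (HpS n). split.
      + apply blaschke2_slopes; lra.
      + apply blaschke2_slope_near_1; lra. }
  set (G := IFS_limit h q).
  set (f := fun n z => mobius (p n) (h n z)).
  assert (Hf : forall n, holomorphic_map_into X (f n)).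
  { intros n. split.
    - intros z Hz. unfold Defs.Delta in Hz. pose proof (Cmod_ge_0 z).
      set (r := (1 + Cmod z) / 2). assert (Hr : Cmod z < r < 1) by (unfold r; lra).
      destruct (Hsl r ltac:(lra)) as [K [HK HS]]. destruct (HS n) as [S1 _].
      eexists. eapply slopes_is_derive; [| apply Hr].
      pose proof (half_pow_pos n). specialize (Hp1 n).
      apply (slopes_comp r 1 _ _ _ _ _ _ _ _ (mobius_slopes (p n) ltac:(lra)) S1).
      + intros y Hy. destruct (Hlt n y) ; lra.
      + nra.
      + apply Rlt_le, Rdiv_lt_0_compat; lra.
      + apply Rlt_le, Rdiv_lt_0_compat; [lra | apply pow_lt; lra].
    - intros z Hz. apply Hp, Hlt, Hz. }
  assert (HIFS : forall n z, Cmod z < 1 -> IFS f n z = mobius (p O) (IFS h n z)).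
  { apply IFS_cancel_mobius.
    - apply Hp1.
    - intros n z Hz. specialize (Hcontr n z Hz). lra.
    - intros n z Hz. apply blaschke2_mobius; [apply Hp1 | lra]. }
  assert (HG : forall z, Cmod z < 1 -> Cmod (G z) <= Cmod z).
  { apply IFS_limit_contracts; assumption. }
  pose proof (mobius_slopes (p O) (proj2 (Hp1 O))) as SA.
  set (L := 2 / (1 - Cmod (p O))) in SA. set (M := 2 / (1 - Cmod (p O)) ^ 2) in SA.
  specialize (Hp1 O) as Hp0.
  assert (HL : 0 <= L) by (apply Rlt_le, Rdiv_lt_0_compat; lra).
  assert (HM : 0 <= M) by (apply Rlt_le, Rdiv_lt_0_compat; [lra | apply pow_lt; lra]).
  intros Hdeg. specialize (Hdeg f Hf (fun z => mobius (p O) (G z))).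
  destruct Hdeg as [c Hc].
  - split.
    + intros z Hz. unfold Defs.Delta in Hz. pose proof (Cmod_ge_0 z).
      set (r := (1 + Cmod z) / 2). assert (Hr : Cmod z < r < 1) by (unfold r; lra).
      destruct (IFS_limit_slopes h q Hcontr Hsl r ltac:(lra)) as [E [HE S1]].
      eexists. eapply slopes_is_derive; [| apply Hr].
      apply (slopes_comp r 1 _ _ _ _ _ _ _ _ SA S1); try assumption.
      intros y Hy. specialize (HG y ltac:(lra)). unfold G in HG. lra.
    + exists (fun n => n). split; [auto|].
      intros K HK HKD eps Heps.
      destruct (compact_in_smaller_disk K HK HKD) as [r [Hr HKr]].
      destruct (IFS_limit_uniform h q Hcontr Hsl r Hr) as [B [HB HU]].
      destruct (half_pow_small (eps / (L * B + 1))) as [N HN].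
      { apply Rdiv_lt_0_compat; nra. }
      exists N. intros n Hn z Hz. specialize (HN n Hn). specialize (HKr z Hz).
      specialize (HU n z HKr). fold G in HU.
      rewrite HIFS by lra.
      pose proof (IFS_contracts h Hcontr n z ltac:(lra)). specialize (HG z ltac:(lra)).
      eapply Rle_lt_trans; [apply (slopes_fun_lip _ _ _ _ _ SA); lra|].
      apply (Rmult_lt_compat_l (L * B + 1)) in HN; [|nra].
      replace ((L * B + 1) * (eps / (L * B + 1))) with eps in HN by (field; nra).
      pose proof (half_pow_pos n).
      assert (L * Cmod (IFS h n z - G z) <= L * (B * (1 / 2) ^ n))
        by (now apply Rmult_le_compat_l).
      nra.
  - destruct (IFS_limit_nonconstant h q Hcontr Hsl) as [z [Hz HGz]].
    + intros n. replace ((1 / 2) ^ n / 4) with (2 * e n) by (unfold e; field).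
      specialize (He n). specialize (Hp1 (S n)). specialize (HpS n).
      apply blaschke2_slope_0; lra.
    + assert (H0 : Cmod 0 < 1) by (rewrite Cmod_0; lra).
      apply HGz. replace (RtoC 0) with (G 0) by (unfold G, IFS_limit; ring).
      pose proof (HG z Hz). pose proof (HG 0 H0).
      apply (mobius_injective (p O)); [apply Hp0 | fold (G z); lra | lra |].
      rewrite (Hc 0 H0). exact (Hc z Hz).
Qed.
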